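(* Let $G$ be a finite graph on $n$ vertices $\{x_1,\ldots,x_n\}$ (no loops, no multiple edges, no isolated vertices) and $\mathfrak{c}\in\mathbb{Z}_{>0}^n$. Suppose that $\delta_{\mathfrak{c}}(I(G))=2$. Then the toric ideal $J_{\mathcal{B}(G,\mathfrak{c})}$ of $\mathcal{B}(G,\mathfrak{c})$ is generated by symmetric exchange binomials.
   Context: Let $S=K[x_1,\ldots,x_n]$ over a field $K$ and let $I(G)$ be the edge ideal of $G$, generated by $x_ix_j$ for each edge $\{x_i,x_j\}$. For $q\geq1$ and $\mathfrak{c}=(c_1,\ldots,c_n)\in\mathbb{Z}_{>0}^n$, $(I(G)^q)_{\mathfrak{c}}$ denotes the monomial ideal generated by the monomials $x_1^{a_1}\cdots x_n^{a_n}\in I(G)^q$ with $a_i\leq c_i$ for all $i$; $\delta_{\mathfrak{c}}(I(G))$ is the largest $q$ with $(I(G)^q)_{\mathfrak{c}}\neq(0)$; and $\mathcal{B}(G,\mathfrak{c})$ is the minimal set of monomial generators of $(I(G)^{\delta_{\mathfrak{c}}(I(G))})_{\mathfrak{c}}$ (it is known to be a polymatroid). For a finite set of monomials $\mathcal{B}=\{w_1,\ldots,w_s\}$, let $T=K[z_1,\ldots,z_s]$ and $\pi:T\to K[w_1,\ldots,w_s]$ with $\pi(z_i)=w_i$; the toric ideal is $J_{\mathcal{B}}=\ker\pi$. A symmetric exchange binomial of $\mathcal{B}$ is a binomial $z_iz_j-z_{i_0}z_{j_0}$ where $w_i=x_1^{a_1}\cdots x_n^{a_n}$, $w_j=x_1^{b_1}\cdots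 x_n^{b_n}$, and there are indices $\xi,\rho$ with $a_\xi>b_\xi$, $a_\rho<b_\rho$ such that $w_{i_0}=x_\rho w_i/x_\xi$ and $w_{j_0}=x_\xi w_j/x_\rho$ both belong to $\mathcal{B}$. *)

(* Defs.v *)
From HB Require Import structures.
From mathcomp Require Import all_boot all_order all_algebra.
From mathcomp Require Export mpoly.

Set Implicit Arguments.
Unset Strict Implicit.
Unset Printing Implicit Defensive.

Import GRing.Theory.
Local Open Scope ring_scope.

Definition in_ideal (R : comNzRingType) (S : R -> Prop) (p : R) : Prop :=
  exists (k : nat) (r g : 'I_k -> R),
    (forall i, S (g i)) /\ p = \sum_(i < k) r i * g i.

Definition ideal_pow (R : comNzRingType) (I : R -> Prop) (q : nat) : R -> Prop :=
  in_ideal (fun p => exists f : 'I_q -> R, (forall i, I (f i)) /\ p = \prod_(i < q) f i).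

Definition simple_graph_no_isolated (n : nat) (e : rel 'I_n) : Prop :=
  (forall i j, e i j = e j i) /\ (forall i, ~~ e i i) /\ (forall i, exists j, e i j).

Definition edge_ideal (K : fieldType) (n : nat) (e : rel 'I_n) : {mpoly K[n]} -> Prop :=
  in_ideal (fun p => exists i j, e i j /\ p = 'X_i * 'X_j).

Definition bounded_by (n : nat) (c : 'I_n -> nat) (m : 'X_{1..n}) : bool :=
  [forall i, (m i <= c i)%N].

Definition restr_pow_nonzero (K : fieldType) (n : nat) (e : rel 'I_n)
    (c : 'I_n -> nat) (q : nat) : Prop :=
  exists m : 'X_{1..n}, bounded_by c m /\ ideal_pow (@edge_ideal K n e) q 'X_[m].

Definition delta_c_eq (K : fieldType) (n : nat) (e : rel 'I_n)
    (c : 'I_n -> nat) (d : nat) : Prop :=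
  restr_pow_nonzero K e c d /\ (forall q, d < q -> ~ restr_pow_nonzero K e c q)%N.

Definition restr_gen (K : fieldType) (n : nat) (e : rel 'I_n)
    (c : 'I_n -> nat) (q : nat) (m : 'X_{1..n}) : Prop :=
  bounded_by c m /\ ideal_pow (@edge_ideal K n e) q 'X_[m].

Definition min_gen (K : fieldType) (n : nat) (e : rel 'I_n)
    (c : 'I_n -> nat) (q : nat) (m : 'X_{1..n}) : Prop :=
  restr_gen K e c q m /\
  (forall m' : 'X_{1..n}, restr_gen K e c q m' -> [forall i, (m' i <= m i)%N] -> m' = m).

(* Symmetric exchange binomial of B = {w_0,...,w_{s-1}} (w injective):
   z_i z_j - z_i0 z_j0 with w_i = x^a, w_j = x^b, a_xi > b_xi, a_rho < b_rho,
   w_i0 = x_rho w_i / x_xi, w_j0 = x_xi w_j / x_rho. *)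
Definition sym_exchange_binomial (K : fieldType) (n s : nat)
    (w : 'I_s -> 'X_{1..n}) (p : {mpoly K[s]}) : Prop :=
  exists (i j i0 j0 : 'I_s) (xi rho : 'I_n),
    (w j xi < w i xi)%N /\ (w i rho < w j rho)%N /\
    (forall k, w i0 k = (w i k + (k == rho)) - (k == xi))%N /\
    (forall k, w j0 k = (w j k + (k == xi)) - (k == rho))%N /\
    p = 'X_i * 'X_j - 'X_i0 * 'X_j0.

Definition toric_map (K : fieldType) (n s : nat) (w : 'I_s -> 'X_{1..n})
    (p : {mpoly K[s]}) : {mpoly K[n]} :=
  p \mPo [tuple 'X_[w i] | i < s].

(* Main.v *)
Require Import Defs.
From HB Require Import structures.
From mathcomp Require Import all_boot all_order all_algebra.
From mathcomp Require Import mpoly zify.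

(* The elements of B(G, c) are the degree vectors of the c-bounded multisets of
   two edges, which are the largest ones possible.  Splitting the difference of
   two such multisets into alternating trails, maximality forces every trail to
   join a vertex x where the first degree is larger to a vertex y where it is
   smaller, and any set of trails can be switched.  So B has a strong exchange
   property: a - b is a sum of differences x - y any subset of which may be
   exchanged between a and b without leaving B.

   Given two monomials of T with the same image, first apply exchanges that
   decrease the sum of the squares of the exponents, until in each monomial any
   two factors differ by at most one in every coordinate.  If the two lists of
   factors still differ, pick a coordinate and positions i, j where their
   differences have opposite signs, and consider the multigraph of the exchange
   pairs of the two i-th and j-th factors.  An orientation of it with in- and
   outdegree differing by at most one everywhere says which pairs to exchange in
   order to bring the two lists closer. *)

Set Implicit Arguments.
Unset Strict Implicit.

Import Order.TTheory GRing.Theory Num.Theory.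
Local Open Scope ring_scope.

(** * Pairs of vertices as directed edges, and balanced orientations *)

Definition excess (n : nat) (P : seq ('I_n * 'I_n)) (v : 'I_n) : int :=
  \sum_(p <- P) ((p.1 == v)%:Z - (p.2 == v)%:Z).

(** The mark [true] reverses a pair: this is outdegree minus indegree of the multigraph after the
    reversals. For pairs that decompose a - b, it is the difference left once the marked pairs have
    been exchanged between a and b. *)
Definition signed_excess (n : nat) (L : seq (bool * ('I_n * 'I_n))) (v : 'I_n) : int :=
  \sum_(l <- L) (if l.1 then -1 else 1) * ((l.2.1 == v)%:Z - (l.2.2 == v)%:Z).

Definition flipped (n : nat) (L : seq (bool * ('I_n * 'I_n))) : seq ('I_n * 'I_n) :=
  [seq l.2 | l <- L & l.1].

Lemma excess_cons (n : nat) (p : 'I_n * 'I_n) P v :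
  excess (p :: P) v = (p.1 == v)%:Z - (p.2 == v)%:Z + excess P v.
Proof. by rewrite /excess big_cons. Qed.

Lemma signed_excess_cons (n : nat) (b : bool) (p : 'I_n * 'I_n) L v :
  signed_excess ((b, p) :: L) v =
  (if b then -1 else 1) * ((p.1 == v)%:Z - (p.2 == v)%:Z) + signed_excess L v.
Proof. by rewrite /signed_excess big_cons. Qed.

Lemma signed_excessE (n : nat) (L : seq (bool * ('I_n * 'I_n))) v :
  signed_excess L v =
  excess [seq l.2 | l <- L] v - 2 * excess (flipped L) v.
Proof.
elim: L => [|[b p] L IH]; first by rewrite /excess /signed_excess !big_nil.
rewrite signed_excess_cons IH /flipped /= excess_cons.
by case: b => /=; rewrite ?excess_cons; lia.
Qed.

Definition complement (n : nat) (L : seq (bool * ('I_n * 'I_n))) :=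
  [seq (~~ l.1, l.2) | l <- L].

Lemma complementK n (L : seq (bool * ('I_n * 'I_n))) :
  [seq l.2 | l <- complement L] = [seq l.2 | l <- L].
Proof. by rewrite -map_comp; apply: eq_map. Qed.

Lemma excess_complement n (L : seq (bool * ('I_n * 'I_n))) v :
  excess [seq l.2 | l <- L] v = excess (flipped L) v + excess (flipped (complement L)) v.
Proof.
elim: L => [|[b p] L IH]; first by rewrite /excess !big_nil addr0.
by rewrite /= excess_cons IH /flipped; case: b => /=; rewrite excess_cons; lia.
Qed.

(** The pairs, seen as edges of a multigraph, can be oriented with in- and outdegree at most one
    apart at every vertex. *)
Definition balanceable (n : nat) (P : seq ('I_n * 'I_n)) : Prop :=
  exists2 L, [seq l.2 | l <- L] = P & forall v, `|signed_excess L v| <= 1.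

Lemma balanceable_perm (n : nat) (P Q : seq ('I_n * 'I_n)) :
  perm_eq P Q -> balanceable P -> balanceable Q.
Proof.
rewrite perm_sym => QP [L LP bL].
(* [perm_iotaP] needs a default pair, so the empty list is set apart. The marks of [L] then follow
   the permutation of the indices. *)
case: Q QP => [|q0 Q'].
  by move=> _; exists [::] => // v; rewrite /signed_excess big_nil.
move: (q0 :: Q') => Q /(perm_iotaP q0)[Is pI EQ].
have szL : size P = size L by rewrite -LP size_map.
exists [seq nth (true, q0) L i | i <- Is].
  rewrite EQ -map_comp; apply/eq_in_map => i; rewrite (perm_mem pI) mem_iota /=.
  by rewrite add0n szL => lt_i; rewrite -LP (nth_map (true, q0)).
move=> v; suff -> : signed_excess [seq nth (true, q0) L i | i <- Is] v
  = signed_excess L v by [].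
apply: perm_big; rewrite -[X in perm_eq _ X](mkseq_nth (true, q0)) /mkseq -szL.
exact: perm_map.
Qed.

Lemma balanceable_swap (n : nat) (x y : 'I_n) P :
  balanceable ((x, y) :: P) -> balanceable ((y, x) :: P).
Proof.
case=> [[|[b p] L] //= [-> LP] bL]; exists ((~~ b, (y, x)) :: L) => [|v].
  by rewrite /= LP.
by move: (bL v); rewrite !signed_excess_cons /=; case: (b) => /=; lia.
Qed.

(** If both halves of the subdivided edge inherit its mark, their contributions at [y] cancel. *)
Lemma balanceable_merge (n : nat) (x y z : 'I_n) P :
  balanceable ((x, z) :: P) -> balanceable ((x, y) :: (y, z) :: P).
Proof.
case=> [[|[b p] L] //= [-> LP] bL].
exists ((b, (x, y)) :: (b, (y, z)) :: L) => [|v]; first by rewrite /= LP.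
by move: (bL v); rewrite !signed_excess_cons /=; case: (b) => /=; lia.
Qed.

(* Two edges sharing a vertex behave like the single edge joining their other
   ends, so one may merge edges until no two of them meet. *)
Lemma balanced_orientation (n : nat) (P : seq ('I_n * 'I_n)) : balanceable P.
Proof.
have [k] := ubnP (size P); elim: k P => // k IH [|[x y] P] /= ltPk.
  by exists [::] => // v; rewrite /signed_excess big_nil.
(* Some edge of [Q] meets [z]: it is brought next to (u, z), turned so as to start at [z], and
   merged with it, which shortens the list. *)
have merge_at (z u : 'I_n) (Q : seq ('I_n * 'I_n)) :
      (size Q < k)%N -> has (fun p => (p.1 == z) || (p.2 == z)) Q ->
    balanceable ((u, z) :: Q).
  move=> ltQk /hasP[[p1 p2] pQ /= zp]; have pR := perm_to_rem pQ.
  have ltR q : (size (q :: rem (p1, p2) Q) < k)%N by move: ltQk; rewrite (perm_size pR).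
  have swap2 (q q' : 'I_n * 'I_n) R : balanceable (q :: q' :: R) -> balanceable (q' :: q :: R).
    by apply: balanceable_perm; rewrite (perm_catCA [:: q] [:: q'] R).
  apply: (@balanceable_perm _ ((u, z) :: (p1, p2) :: rem (p1, p2) Q)).
    by rewrite perm_sym perm_cons.
  case/orP: zp => /eqP <-; first exact/balanceable_merge/IH/ltR.
  exact/swap2/balanceable_swap/swap2/balanceable_merge/IH/ltR.
have [touch_y|free_y] := boolP (has (fun p => (p.1 == y) || (p.2 == y)) P).
  exact: merge_at.
have [touch_x|free_x] := boolP (has (fun p => (p.1 == x) || (p.2 == x)) P).
  exact/balanceable_swap/merge_at.
(* No edge of [P] meets [x] or [y], so either orientation of (x, y) will do. *)
have [L LP bL] := IH P ltPk.
exists ((false, (x, y)) :: L) => [|v]; first by rewrite /= LP.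
rewrite signed_excess_cons /=.
have free_excess u : ~~ has (fun p => (p.1 == u) || (p.2 == u)) P -> signed_excess L u = 0.
  rewrite -LP has_map => /hasPn free_u; rewrite /signed_excess big_seq big1 // => l.
  by move=> /free_u /= /norP[/negPf-> /negPf->]; rewrite subrr mulr0.
have [<-|nxv] := eqVneq x v; first by rewrite free_excess //; case: (y == x).
have [<-|nyv] := eqVneq y v; first by rewrite free_excess.
by rewrite subrr mulr0 add0r.
Qed.

(** * Degree vectors of edge multisets, and alternating trails *)

Definition degs (n : nat) (M : seq ('I_n * 'I_n)) : 'X_{1..n} :=
  (\sum_(p <- M) (U_(p.1) + U_(p.2)))%MM.

Lemma degs_cat n (M N : seq ('I_n * 'I_n)) : degs (M ++ N) = (degs M + degs N)%MM.
Proof. exact: big_cat. Qed.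

Lemma degs_cons n (p : 'I_n * 'I_n) M : degs (p :: M) = (U_(p.1) + U_(p.2) + degs M)%MM.
Proof. exact: big_cons. Qed.

Lemma degs_nil n : degs (n := n) [::] = 0%MM.
Proof. exact: big_nil. Qed.

Lemma degs_flatten_perm n (T : eqType) (f : T -> seq ('I_n * 'I_n)) (s t : seq T) :
  perm_eq s t -> degs (flatten [seq f x | x <- s]) = degs (flatten [seq f x | x <- t]).
Proof. by move=> st; apply/perm_big/perm_flatten/perm_map. Qed.

Lemma mdeg_degs n (M : seq ('I_n * 'I_n)) : mdeg (degs M) = (size M).*2.
Proof.
elim: M => [|p M IH]; first by rewrite degs_nil mdeg0.
by rewrite degs_cons !mdegD !mdeg1 IH.
Qed.

(* An alternating trail [((A, B), (t1, t2))]: [A] and [B] are its edges in the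
   first and in the second matching, and the signed ends [t1], [t2] record where
   the degrees of [A] and [B] differ; the sign is [true] at an end in [A]. *)
Definition trail (n : nat) : Type :=
  (seq ('I_n * 'I_n) * seq ('I_n * 'I_n) * ((bool * 'I_n) * (bool * 'I_n)))%type.

Definition end_value (n : nat) (t : bool * 'I_n) (v : 'I_n) : int :=
  (if t.1 then 1 else -1) * (t.2 == v)%:Z.

(** Only degrees matter in what follows, so the order of the edges along the trail is not
    recorded. *)
Definition is_trail (n : nat) (e : rel 'I_n) (t : trail n) : Prop :=
  [/\ all (fun p => e p.1 p.2) t.1.1, all (fun p => e p.1 p.2) t.1.2 &
      forall v, (degs t.1.1 v)%:Z - (degs t.1.2 v)%:Z
                = end_value t.2.1 v + end_value t.2.2 v].

Definition ends (n : nat) (T : seq (trail n)) : seq (bool * 'I_n) :=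
  flatten [seq [:: t.2.1; t.2.2] | t : trail n <- T].

Definition fst_edges (n : nat) (T : seq (trail n)) := flatten [seq t.1.1 | t : trail n <- T].
Definition snd_edges (n : nat) (T : seq (trail n)) := flatten [seq t.1.2 | t : trail n <- T].

(** A trail can be read from either end, so one that ends at [z] may be assumed to start there. *)
Lemma trail_pull n (e : rel 'I_n) (T : seq (trail n)) (z : bool * 'I_n) :
  {in T, forall t, is_trail e t} -> z \in ends T ->
  exists (A B : seq ('I_n * 'I_n)) (y : bool * 'I_n) (T1 : seq (trail n)),
    [/\ is_trail e (A, B, (z, y)), {in T1, forall t, is_trail e t},
        degs (fst_edges T) = (degs A + degs (fst_edges T1))%MM,
        degs (snd_edges T) = (degs B + degs (snd_edges T1))%MM &
        size T = (size T1).+1 /\ ends T =i z :: y :: ends T1].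
Proof.
move=> trT /flatten_mapP[[[A B] [t1 t2]] tT zt]; have pT := perm_to_rem tT.
have tr1 : {in rem (A, B, (t1, t2)) T, forall t, is_trail e t}.
  by move=> t /mem_rem; apply: trT.
have [eA eB dAB] := trT _ tT.
have endsT : ends T =i [:: t1, t2 & ends (rem (A, B, (t1, t2)) T)].
  by apply: perm_mem; apply: (perm_flatten (perm_map _ pT)).
have fT : degs (fst_edges T) =
    (degs A + degs (fst_edges (rem (A, B, (t1, t2)) T)))%MM.
  by rewrite /fst_edges (degs_flatten_perm _ pT) /= degs_cat.
have sT : degs (snd_edges T) =
    (degs B + degs (snd_edges (rem (A, B, (t1, t2)) T)))%MM.
  by rewrite /snd_edges (degs_flatten_perm _ pT) /= degs_cat.
move: zt; rewrite !inE /= => /orP[]/eqP->.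
  exists A, B, t2, (rem (A, B, (t1, t2)) T).
  by split=> //; split; [rewrite (perm_size pT) | ].
exists A, B, t1, (rem (A, B, (t1, t2)) T); split=> //.
  by split=> // v; rewrite [RHS]addrC; apply: dAB.
by split=> [|z']; [rewrite (perm_size pT) | rewrite endsT !inE orbCA].
Qed.

(** Two trails that end at the same vertex with opposite signs are joined there into one. A single
    trail with two such ends is closed, so both its sides have the same degrees and one of them can
    move to the common part. Either way the number of trails drops. *)
Lemma untangle n (e : rel 'I_n) (A0 : seq ('I_n * 'I_n)) (T : seq (trail n)) :
  all (fun p => e p.1 p.2) A0 -> {in T, forall t, is_trail e t} ->
  exists (A1 : seq ('I_n * 'I_n)) (T1 : seq (trail n)),
    [/\ all (fun p => e p.1 p.2) A1, {in T1, forall t, is_trail e t},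
        degs (A0 ++ fst_edges T) = degs (A1 ++ fst_edges T1),
        degs (A0 ++ snd_edges T) = degs (A1 ++ snd_edges T1) &
        forall v, (true, v) \in ends T1 -> (false, v) \notin ends T1].
Proof.
have [k] := ubnP (size T); elim: k A0 T => // k IH A0 T ltTk eA0 trT.
have [/hasP[[[] v] //= vT v'T]|/hasPn noopp] :=
    boolP (has (fun z : bool * 'I_n => z.1 && ((false, z.2) \in ends T)) (ends T)); last first.
  by exists A0, T; split=> // v vT; apply: (noopp _ vT).
have [A [B [y [T1 [[/= eA eB dAB] trT1 fT sT [szT endsT]]]]]] := trail_pull trT vT.
move: v'T; rewrite endsT !inE /= => /orP[/eqP Ey|v'T1].
  have [||A1 [T2 [eA1 trT2 f2 s2 no2]]] := IH (A0 ++ A) T1 _ _ trT1.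
  - by rewrite -ltnS -szT.
  - by rewrite all_cat eA0.
  exists A1, T2; split=> //; rewrite -?f2 -?s2 !degs_cat ?fT ?sT addmA //.
  congr (_ + _ + _)%MM; apply/mnmP => u; move: (dAB u).
  by rewrite -Ey /end_value /=; lia.
have [A' [B' [y' [T2 [[/= eA' eB' dAB'] trT2 fT1 sT1 [szT1 endsT1]]]]]] := trail_pull trT1 v'T1.
have [|//||A1 [T3 [eA1 trT3 f3 s3 no3]]] := IH A0 ((A ++ A', B ++ B', (y, y')) :: T2).
- by rewrite /= -szT1 -ltnS -szT.
- move=> t; rewrite inE => /predU1P[->|]; last exact: trT2.
  split=> [||u] /=; rewrite ?all_cat ?eA ?eB //.
  by move: (dAB u) (dAB' u); rewrite !degs_cat !mnmDE /end_value /=; lia.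
exists A1, T3; split=> //; rewrite -?f3 -?s3 /fst_edges /snd_edges /=.
  by rewrite !degs_cat fT fT1 !addmA.
by rewrite !degs_cat sT sT1 !addmA.
Qed.

Lemma end_valueE n (t : bool * 'I_n) v :
  end_value t v = (t == (true, v))%:Z - (t == (false, v))%:Z.
Proof. by case: t => [[] u]; rewrite /end_value !xpair_eqE /=; lia. Qed.

Lemma degs_ends n (e : rel 'I_n) (T : seq (trail n)) v :
  {in T, forall t, is_trail e t} ->
  (degs (fst_edges T) v)%:Z - (degs (snd_edges T) v)%:Z =
  (count_mem (true, v) (ends T))%:Z - (count_mem (false, v) (ends T))%:Z.
Proof.
elim: T => [|t T IH] trT; first by rewrite /fst_edges /snd_edges /= degs_nil mnm0E.
have [_ _ /(_ v)] := trT _ (mem_head _ _).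
have {IH} := IH (fun u uT => trT u (mem_behead (s := t :: T) uT)).
rewrite /fst_edges /snd_edges /ends /= !degs_cat !mnmDE !end_valueE; lia.
Qed.

Lemma all_fst_edges n (e : rel 'I_n) (T : seq (trail n)) :
  {in T, forall t, is_trail e t} -> all (fun p => e p.1 p.2) (fst_edges T).
Proof.
by move=> trT; apply/allP => p /flatten_mapP[t /trT[/allP eA _ _]]; apply: eA.
Qed.

Lemma all_snd_edges n (e : rel 'I_n) (T : seq (trail n)) :
  {in T, forall t, is_trail e t} -> all (fun p => e p.1 p.2) (snd_edges T).
Proof.
by move=> trT; apply/allP => p /flatten_mapP[t /trT[_ /allP eB _]]; apply: eB.
Qed.

Lemma mdeg_eq_add2 n (m m' : 'X_{1..n}) (x y : 'I_n) :
  (forall v, (m v)%:Z = (m' v)%:Z + (x == v)%:Z + (y == v)%:Z) -> mdeg m = (mdeg m').+2.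
Proof.
move=> mE; suff -> : m = (m' + U_(x) + U_(y))%MM by rewrite !mdegD !mdeg1 !addn1.
by apply/mnmP => v; rewrite !mnmDE !mnm1E; move: (mE v); lia.
Qed.

(** * The strong exchange property for maximum matchings *)

(** The marks of [L] choose an arbitrary subset of the pairs, taken with multiplicity, to be
    exchanged all at once. *)
Definition exchange_pairing (n : nat) (B : 'X_{1..n} -> Prop) (a b : 'X_{1..n})
    (P : seq ('I_n * 'I_n)) : Prop :=
  [/\ {in P, forall p, (b p.1 < a p.1)%N /\ (a p.2 < b p.2)%N},
      forall v, (a v)%:Z - (b v)%:Z = excess P v &
      forall L, [seq l.2 | l <- L] = P ->
        exists2 m, B m & forall v, (m v)%:Z = (a v)%:Z - excess (flipped L) v].

(** Edges may repeat: these are the degree vectors of the b-matchings with [q] edges and vertex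
    capacities [c]. *)
Definition matching_degrees (n : nat) (e : rel 'I_n) (c : 'I_n -> nat) (q : nat)
    (m : 'X_{1..n}) : Prop :=
  exists M, [/\ size M = q, all (fun p => e p.1 p.2) M, degs M = m & bounded_by c m].

(** For a trail with ends of opposite signs, the positive end comes first. *)
Definition pair_of (n : nat) (t : trail n) : 'I_n * 'I_n :=
  if t.2.1.1 then (t.2.1.2, t.2.2.2) else (t.2.2.2, t.2.1.2).

Lemma pair_ofE n (e : rel 'I_n) (t : trail n) v :
  is_trail e t -> t.2.1.1 != t.2.2.1 ->
  (degs t.1.1 v)%:Z - (degs t.1.2 v)%:Z =
    ((pair_of t).1 == v)%:Z - ((pair_of t).2 == v)%:Z.
Proof.
case: t => [[A B] [[[] x] [[] y]]] //= [_ _ /(_ v) -> _];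
by rewrite /end_value /pair_of /=; lia.
Qed.

(** Exchanging a pair amounts to replacing the first side of its trail by the second, independently
    of the other trails. *)
Lemma swap_trails n (e : rel 'I_n) (T : seq (trail n)) L :
  {in T, forall t, is_trail e t} -> {in T, forall t, t.2.1.1 != t.2.2.1} ->
  [seq l.2 | l <- L] = [seq pair_of t | t <- T] ->
  exists2 M, all (fun p => e p.1 p.2) M &
    forall v, (degs M v)%:Z = (degs (fst_edges T) v)%:Z - excess (flipped L) v.
Proof.
elim: T L => [[]//|t T IH [|[s p] L] //= trT mixed [-> LP]].
  by move=> _ _ _; exists [::] => // v; rewrite /fst_edges /excess /= big_nil subr0.
have tT := mem_head t T; have subT u : u \in T -> u \in t :: T by rewrite inE orbC => ->.
have [u uT|u uT|M eM dM] := IH L _ _ LP; [exact/trT/subT | exact/mixed/subT |].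
have [eA eB _] := trT t tT.
exists ((if s then t.1.2 else t.1.1) ++ M) => [|v].
  by rewrite all_cat eM andbT; case: s.
move: (pair_ofE v (trT t tT) (mixed t tT)) (dM v).
rewrite /fst_edges /flipped /=; case: s => /=; rewrite ?excess_cons !degs_cat !mnmDE; lia.
Qed.

Lemma degs_pair_of n (e : rel 'I_n) (T : seq (trail n)) v :
  {in T, forall t, is_trail e t} -> {in T, forall t, t.2.1.1 != t.2.2.1} ->
  (degs (fst_edges T) v)%:Z - (degs (snd_edges T) v)%:Z =
    excess [seq pair_of t | t <- T] v.
Proof.
elim: T => [|t T IH] trT mixed; first by rewrite /excess big_nil degs_nil !mnm0E.
have tT := mem_head t T; have subT u : u \in T -> u \in t :: T by rewrite inE orbC => ->.
rewrite /= excess_cons -(pair_ofE v (trT t tT) (mixed t tT)) -IH.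
- by rewrite /fst_edges /snd_edges /= !degs_cat !mnmDE; lia.
- by move=> u uT; apply/trT/subT.
- by move=> u uT; apply/mixed/subT.
Qed.

(** A vertex with a larger than b occurs only as a first entry and one with a smaller only as a
    second, so all contributions at [v] have the same sign. The bound by the full excess is the sign
    of the complementary part. *)
Lemma flipped_bounds n (P : seq ('I_n * 'I_n)) (a b : 'I_n -> nat) L v :
  {in P, forall p, (b p.1 < a p.1)%N /\ (a p.2 < b p.2)%N} ->
  [seq l.2 | l <- L] = P ->
  if (b v <= a v)%N then 0 <= excess (flipped L) v <= excess P v
  else excess P v <= excess (flipped L) v <= 0.
Proof.
move=> abP; have sign L' : [seq l.2 | l <- L'] = P ->
    if (b v <= a v)%N then 0 <= excess (flipped L') v else excess (flipped L') v <= 0.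
  move=> LP; have inP p : p \in flipped L' -> p \in P.
    by move=> /mapP[l]; rewrite mem_filter => /andP[_ lL'] ->; rewrite -LP map_f.
  case: ifP => ab; rewrite /excess big_seq;
    [apply: sumr_ge0|apply: sumr_le0] => p /inP/abP[lt1 lt2].
    by have [E|_] := eqVneq p.2 v; move: lt2; rewrite ?E; lia.
  by have [E|_] := eqVneq p.1 v; move: lt1; rewrite ?E; lia.
move=> LP; move: (excess_complement L v) (sign _ LP) (sign (complement L)).
by rewrite complementK LP => -> + /(_ erefl); case: ifP => _; lia.
Qed.

Lemma sum_excess n (P : seq ('I_n * 'I_n)) : \sum_v excess P v = 0.
Proof.
have delta (x : 'I_n) : \sum_(v < n) (x == v)%:Z = 1.
  by rewrite (bigD1 x) //= eqxx big1 ?addr0 // => v; rewrite eq_sym => /negPf->.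
rewrite /excess exchange_big /= big1 // => p _.
by rewrite big_split /= sumrN !delta.
Qed.

Lemma mdeg_excess n (m m' : 'X_{1..n}) (P : seq ('I_n * 'I_n)) :
  (forall v, (m v)%:Z = (m' v)%:Z - excess P v) -> mdeg m = mdeg m'.
Proof.
move=> mE; apply/eqP; rewrite -(eqr_nat int) !mdegE !natr_sum.
under eq_bigr do rewrite natz mE -natz.
by rewrite big_split /= sumrN sum_excess oppr0 addr0.
Qed.

(* In a difference of two maximum matchings every trail has one end of each
   sign, since otherwise it would augment one of the two matchings. *)
Lemma matching_strong_exchange n (e : rel 'I_n) c q (a b : 'X_{1..n}) :
  (forall M, all (fun p => e p.1 p.2) M -> bounded_by c (degs M) -> (size M <= q)%N) ->
  matching_degrees e c q a -> matching_degrees e c q b ->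
  exists P, exchange_pairing (matching_degrees e c q) a b P.
Proof.
move=> maxq [Ma [szMa eMa dMa /forallP ca]] [Mb [szMb eMb dMb /forallP cb]].
have mdega : mdeg a = q.*2 by rewrite -dMa mdeg_degs szMa.
have mdegb : mdeg b = q.*2 by rewrite -dMb mdeg_degs szMb.
(* Initially every edge is a trail of its own, with two ends of the same sign. *)
pose T0 := [seq ([:: p], [::], ((true, p.1), (true, p.2))) : trail n | p <- Ma] ++
           [seq ([::], [:: p], ((false, p.1), (false, p.2))) : trail n | p <- Mb].
have trT0 : {in T0, forall t, is_trail e t}.
  move=> t; rewrite mem_cat => /orP[]/mapP[p pM ->]; split=> //= [|v].
  - by rewrite (allP eMa).
  - by rewrite degs_cons degs_nil !mnmDE mnm0E !mnm1E /end_value /=; lia.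
  - by rewrite (allP eMb).
  - by rewrite degs_cons degs_nil !mnmDE mnm0E !mnm1E /end_value /=; lia.
have [A [T [eA trT]]] := untangle (A0 := [::]) isT trT0.
have -> : fst_edges T0 = Ma.
  rewrite /fst_edges map_cat -!map_comp flatten_cat /= flatten_map1 map_id.
  by elim: (Mb) => //=; rewrite cats0.
have -> : snd_edges T0 = Mb.
  rewrite /snd_edges map_cat -!map_comp flatten_cat /= flatten_map1 map_id.
  by elim: (Ma) => //=; rewrite cats0.
rewrite !cat0s dMa dMb => aE bE noopp.
have abE v := degs_ends v trT.
have aEv v : a v = (degs A v + degs (fst_edges T) v)%N by rewrite aE degs_cat mnmDE.
have bEv v : b v = (degs A v + degs (snd_edges T) v)%N by rewrite bE degs_cat mnmDE.
have count0 v : (count_mem (true, v) (ends T) = 0)%N \/ (count_mem (false, v) (ends T) = 0)%N.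
  have [/noopp/count_memPn|/count_memPn] := boolP ((true, v) \in ends T); by [left|right].
(* A multiset of q + 1 edges whose degrees are at most those of [a] or of [b] at each vertex
   respects [c], against maximality. *)
have overfull M : all (fun p => e p.1 p.2) M -> mdeg (degs M) = q.*2.+2 ->
    (forall v, degs M v <= a v \/ degs M v <= b v)%N -> False.
  move=> eM; rewrite mdeg_degs => szM leM.
  have : (size M <= q)%N.
    apply: maxq => //; apply/forallP => v.
    by have [/leq_trans|/leq_trans] := leM v; apply.
  by move: szM; lia.
have mixed (t : trail n) : t \in T -> t.2.1.1 != t.2.2.1.
  move=> tT; have pT := perm_to_rem tT.
  have [eA' eB' dt] := trT t tT.
  have trR : {in rem t T, forall u, is_trail e u} by move=> u /mem_rem; apply: trT.
  have cE z : (count_mem z (ends T) = (t.2.1 == z) + (t.2.2 == z) + count_mem z (ends (rem t T)))%N.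
    have -> : count_mem z (ends T) = count_mem z (ends (t :: rem t T)).
      by apply/permP/perm_flatten/perm_map.
    by rewrite /= addnA.
  have fE : degs (fst_edges T) = (degs t.1.1 + degs (fst_edges (rem t T)))%MM.
    by rewrite /fst_edges (degs_flatten_perm _ pT) /= degs_cat.
  have sE : degs (snd_edges T) = (degs t.1.2 + degs (snd_edges (rem t T)))%MM.
    by rewrite /snd_edges (degs_flatten_perm _ pT) /= degs_cat.
  case: t eA' eB' dt cE fE sE {tT pT trR} (all_fst_edges trR) (all_snd_edges trR)
    => [[A1 B1] [[[] x1] [[] x2]]] //= eA1 eB1 dt cE fE sE eF eS; exfalso.
    (* Both ends are positive: replacing [B1] by [A1] in the second matching gains an edge. The
       degree grows only at these ends, where no negative end lies, so it stays at most [a]. *)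
    apply: (overfull (A ++ A1 ++ snd_edges (rem ((A1, B1), ((true, x1), (true, x2))) T))).
    + by rewrite !all_cat eA eA1 eS.
    + rewrite -mdegb; apply: (mdeg_eq_add2 (x := x1) (y := x2)) => v.
      rewrite bEv sE !degs_cat !mnmDE; move: (dt v); rewrite /end_value /=; lia.
    move=> v; rewrite bEv aEv !degs_cat !mnmDE.
    move: (abE v) (dt v) (count0 v) (cE (true, v)) (cE (false, v)).
    by rewrite fE sE !mnmDE /end_value !xpair_eqE /=; lia.
  apply: (overfull (A ++ B1 ++ fst_edges (rem ((A1, B1), ((false, x1), (false, x2))) T))).
  + by rewrite !all_cat eA eB1 eF.
  + rewrite -mdega; apply: (mdeg_eq_add2 (x := x1) (y := x2)) => v.
    rewrite aEv fE !degs_cat !mnmDE; move: (dt v); rewrite /end_value /=; lia.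
  move=> v; rewrite bEv aEv !degs_cat !mnmDE.
  move: (abE v) (dt v) (count0 v) (cE (true, v)) (cE (false, v)).
  by rewrite fE sE !mnmDE /end_value !xpair_eqE /=; lia.
have pair_ends (t : trail n) : t \in T ->
    (true, (pair_of t).1) \in ends T /\ (false, (pair_of t).2) \in ends T.
  move=> tT; suff sub : {subset [:: (true, (pair_of t).1); (false, (pair_of t).2)]
      <= [:: t.2.1; t.2.2]}.
    by split; apply/flatten_mapP; exists t => //; apply: sub; rewrite !inE eqxx ?orbT.
  move: (mixed t tT) => /=; case: t {tT} => [[A1 B1] [[[] x1] [[] x2]]] //= _ z;
  by rewrite /pair_of !inE //= orbC.
have abP : {in [seq pair_of t | t <- T], forall p, (b p.1 < a p.1)%N /\ (a p.2 < b p.2)%N}.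
  move=> p /mapP[t /pair_ends[tt ft] ->].
  move: (abE (pair_of t).1) (abE (pair_of t).2).
  have tt0 : (0 < count_mem (true, (pair_of t).1) (ends T))%N by rewrite -has_count has_pred1.
  have ff0 : (0 < count_mem (false, (pair_of t).2) (ends T))%N by rewrite -has_count has_pred1.
  move: (count0 (pair_of t).1) (count0 (pair_of t).2) tt0 ff0.
  by rewrite !aEv !bEv; move: (pair_of t) => {}p /=; lia.
have excE v : (a v)%:Z - (b v)%:Z = excess [seq pair_of t | t <- T] v.
  by rewrite aEv bEv -(degs_pair_of _ trT mixed); lia.
exists [seq pair_of t | t <- T]; split=> // L LP.
have [M eM dM] := swap_trails trT mixed LP.
have dAM v : (degs (A ++ M) v)%:Z = (a v)%:Z - excess (flipped L) v.
  by rewrite degs_cat mnmDE aEv !PoszD dM; lia.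
(* At each vertex the new degree lies between those of [a] and [b]. *)
have cAM : bounded_by c (degs (A ++ M)).
  apply/forallP => v; move: (flipped_bounds v abP LP) (ca v) (cb v) (excE v) (dAM v).
  by case: ifP; lia.
exists (degs (A ++ M)) => //; exists (A ++ M); split=> //; last by rewrite all_cat eA.
by apply: double_inj; rewrite -mdeg_degs -mdega; apply: mdeg_excess dAM.
Qed.

(** * Ideals and congruence modulo an ideal *)

Lemma in_ideal0 (R : comNzRingType) (S : R -> Prop) : in_ideal S 0.
Proof. by exists 0%N, (fun=> 0), (fun=> 0); split=> [[]//|]; rewrite big_ord0. Qed.

Lemma in_ideal_gen (R : comNzRingType) (S : R -> Prop) p : S p -> in_ideal S p.
Proof. by move=> Sp; exists 1%N, (fun=> 1), (fun=> p); split=> //; rewrite big_ord1 mul1r. Qed.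

Lemma in_idealMl (R : comNzRingType) (S : R -> Prop) q p : in_ideal S p -> in_ideal S (q * p).
Proof.
move=> [k [r [g [Sg ->]]]]; exists k, (fun i => q * r i), g; split=> //.
by rewrite mulr_sumr; apply: eq_bigr => i _; rewrite mulrA.
Qed.

Lemma in_idealD (R : comNzRingType) (S : R -> Prop) p q :
  in_ideal S p -> in_ideal S q -> in_ideal S (p + q).
Proof.
move=> [k [r [g [Sg ->]]]] [l [r' [g' [Sg' ->]]]].
exists (k + l)%N, (fun i => match split i with inl j => r j | inr j => r' j end),
  (fun i => match split i with inl j => g j | inr j => g' j end); split.
  by move=> i; case: (split i).
by rewrite big_split_ord; congr (_ + _); apply: eq_bigr => i _;
  rewrite -?[lshift _ _]/(unsplit (inl _)) -?[rshift _ _]/(unsplit (inr _)) unsplitK.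
Qed.

Lemma in_idealN (R : comNzRingType) (S : R -> Prop) p : in_ideal S p -> in_ideal S (- p).
Proof. by rewrite -mulN1r; apply: in_idealMl. Qed.

Definition congr_mod (R : comNzRingType) (S : R -> Prop) (p q : R) : Prop := in_ideal S (p - q).

Lemma congr_mod_refl (R : comNzRingType) (S : R -> Prop) p : congr_mod S p p.
Proof. by rewrite /congr_mod subrr; apply: in_ideal0. Qed.

Lemma congr_mod_sym (R : comNzRingType) (S : R -> Prop) p q : congr_mod S p q -> congr_mod S q p.
Proof. by move/in_idealN; rewrite opprB. Qed.

Lemma congr_mod_trans (R : comNzRingType) (S : R -> Prop) p q r :
  congr_mod S p q -> congr_mod S q r -> congr_mod S p r.
Proof. by move=> pq qr; have := in_idealD pq qr; rewrite subrKA. Qed.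

Lemma congr_modMr (R : comNzRingType) (S : R -> Prop) p q r :
  congr_mod S p q -> congr_mod S (p * r) (q * r).
Proof. by move/(in_idealMl r); rewrite mulrC mulrBl. Qed.

(** * Exchanges between two factors as congruences *)

(** Adding the marked pairs to [b] is the same as removing the unmarked ones from [a]. *)
Lemma exchange_pairing_complement n B (a b : 'X_{1..n}) P L :
  exchange_pairing B a b P -> [seq l.2 | l <- L] = P ->
  exists2 m, B m & forall v, (m v)%:Z = (b v)%:Z + excess (flipped L) v.
Proof.
move=> [_ abE swapP] LP; have := swapP (complement L).
rewrite complementK => /(_ LP)[m Bm mE]; exists m => // v; rewrite mE.
by move: (abE v) (excess_complement L v); rewrite LP; lia.
Qed.

Lemma flip_one n (P : seq ('I_n * 'I_n)) p : p \in P ->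
  exists2 L, [seq l.2 | l <- L] = P & flipped L = [:: p].
Proof.
have flipped0 Q : flipped [seq (false, q) | q : 'I_n * 'I_n <- Q] = [::] by elim: Q.
case/splitPr=> P1 P2.
exists ([seq (false, q) | q <- P1] ++ (true, p) :: [seq (false, q) | q <- P2]).
  by rewrite map_cat /= -!map_comp !map_id.
by rewrite /flipped filter_cat map_cat /= -!/(flipped _) !flipped0.
Qed.

(** No vertex is both a first and a second entry, so its multiplicity is the absolute value of the
    excess there, which is at most one. *)
Lemma uniq_pairing n (P : seq ('I_n * 'I_n)) (a b : 'I_n -> nat) :
  {in P, forall p, (b p.1 < a p.1)%N /\ (a p.2 < b p.2)%N} ->
  (forall v, (a v)%:Z - (b v)%:Z = excess P v) ->
  (forall v, a v <= (b v).+1 /\ b v <= (a v).+1)%N ->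
  uniq [seq p.1 | p <- P] /\ uniq [seq p.2 | p <- P].
Proof.
move=> abP abE bal.
have exE v : excess P v = (count_mem v [seq p.1 | p <- P])%:Z - (count_mem v [seq p.2 | p <- P])%:Z.
  rewrite /excess; elim: (P) => [|p P' IH]; first by rewrite big_nil.
  by rewrite big_cons IH /= !PoszD opprD addrACA.
have disj v : v \in [seq p.1 | p <- P] -> v \notin [seq p.2 | p <- P].
  move=> /mapP[p /abP[ltp _] ->]; apply/mapP => -[q /abP[_ ltq] E].
  by move: ltp ltq; rewrite E; lia.
split; apply: count_mem_uniq => v.
  have [vP|/count_memPn -> //] := boolP (v \in [seq p.1 | p <- P]).
  have /count_memPn c0 := disj v vP; have : (0 < count_mem v [seq p.1 | p <- P])%N.
    by rewrite -has_count has_pred1.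
  by move: (bal v) (abE v) (exE v); rewrite c0; lia.
have [vP|/count_memPn -> //] := boolP (v \in [seq p.2 | p <- P]).
have /count_memPn c0 : v \notin [seq p.1 | p <- P] by apply/negP => /disj; rewrite vP.
have : (0 < count_mem v [seq p.2 | p <- P])%N by rewrite -has_count has_pred1.
by move: (bal v) (abE v) (exE v); rewrite c0; lia.
Qed.

Lemma congr_exchange (K : fieldType) n s (w : 'I_s -> 'X_{1..n}) i j i' j' (x y : 'I_n) :
  (w j x < w i x)%N -> (w i y < w j y)%N ->
  (forall v, (w i' v)%:Z = (w i v)%:Z - ((x == v)%:Z - (y == v)%:Z)) ->
  (forall v, (w j' v)%:Z = (w j v)%:Z + ((x == v)%:Z - (y == v)%:Z)) ->
  congr_mod (@sym_exchange_binomial K n s w) ('X_i * 'X_j) ('X_i' * 'X_j').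
Proof.
move=> ltx lty i'E j'E; apply: in_ideal_gen; exists i, j, i', j', x, y; split=> //; split=> //.
by split=> [v|]; [move: (i'E v)|split=> // v; move: (j'E v)]; rewrite ![v == _]eq_sym;
  lia.
Qed.

(* Distinct pairs have distinct ends here, so each exchange leaves the strict
   inequalities required by the next ones untouched. *)
Lemma congr_flips (K : fieldType) n s (w : 'I_s -> 'X_{1..n}) L i j :
  {in [seq l.2 | l <- L], forall p, (w j p.1 < w i p.1)%N /\ (w i p.2 < w j p.2)%N} ->
  uniq [seq l.2.1 | l <- L] -> uniq [seq l.2.2 | l <- L] ->
  (forall L', [seq l.2 | l <- L'] = [seq l.2 | l <- L] -> exists i' j',
     (forall v, (w i' v)%:Z = (w i v)%:Z - excess (flipped L') v) /\
     (forall v, (w j' v)%:Z = (w j v)%:Z + excess (flipped L') v)) ->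
  exists i' j', [/\ congr_mod (@sym_exchange_binomial K n s w) ('X_i * 'X_j) ('X_i' * 'X_j'),
     forall v, (w i' v)%:Z = (w i v)%:Z - excess (flipped L) v &
     forall v, (w j' v)%:Z = (w j v)%:Z + excess (flipped L) v].
Proof.
elim: L i j => [|[b p] L IH] i j /=.
  move=> _ _ _ _; exists i, j; split=> [|v|v]; rewrite /excess ?big_nil ?subr0 ?addr0 //.
  exact: congr_mod_refl.
move=> ijP /andP[p1L u1] /andP[p2L u2] swap.
have ijL : {in [seq l.2 | l <- L], forall p, (w j p.1 < w i p.1)%N /\ (w i p.2 < w j p.2)%N}.
  by move=> q qL; apply: ijP; rewrite inE qL orbT.
case: b; last first.
  by apply: IH => // L' L'L; have := swap ((false, p) :: L'); rewrite /= L'L => /(_ erefl).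
(* The pair [p] is exchanged alone first, and the induction goes on from the resulting factors. *)
have [L1 L1L f1] : exists2 L1, [seq l.2 | l <- L1] = p :: [seq l.2 | l <- L] & flipped L1 = [:: p].
  exact/flip_one/mem_head.
have [i1 [j1 []]] := swap L1 L1L; rewrite f1.
have e1 v : excess [:: p] v = (p.1 == v)%:Z - (p.2 == v)%:Z.
  by rewrite excess_cons /excess big_nil addr0.
move=> i1E j1E; have [ltp1 ltp2] := ijP p (mem_head _ _).
have step : congr_mod (@sym_exchange_binomial K n s w) ('X_i * 'X_j) ('X_i1 * 'X_j1).
  by apply: (@congr_exchange K n s w i j i1 j1 p.1 p.2) => // v; rewrite -e1.
have [|//|//||i' [j' [ij' i'E j'E]]] := IH i1 j1.
- move=> [q1 q2] qL; have [/= ltq1 ltq2] := ijL _ qL.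
  have n11 : p.1 != q1.
    by apply: contraNneq p1L => ->; rewrite -[q1]/(q1, q2).1;
      have /mapP[l lL ->] := qL; apply: map_f.
  have n22 : p.2 != q2.
    by apply: contraNneq p2L => ->; rewrite -[q2]/(q1, q2).2;
      have /mapP[l lL ->] := qL; apply: map_f.
  have n12 : p.1 != q2 by apply: contraTneq ltq2 => <-; rewrite -leqNgt ltnW.
  have n21 : p.2 != q1 by apply: contraTneq ltq1 => <-; rewrite -leqNgt ltnW.
  move: (i1E q1) (i1E q2) (j1E q1) (j1E q2); rewrite !e1.
  by move: n11 n22 n12 n21 => /negPf-> /negPf-> /negPf-> /negPf->; lia.
- move=> L' L'L; have [|i' [j' [i'E j'E]]] := swap ((true, p) :: L'); first by rewrite /= L'L.
  exists i', j'; split=> v; move: (i'E v) (j'E v) (i1E v) (j1E v);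
  by rewrite /flipped /= !excess_cons /excess big_nil; lia.
exists i', j'; split=> [|v|v]; first exact: congr_mod_trans step ij'.
  by move: (i'E v) (i1E v); rewrite /flipped /= !excess_cons /excess big_nil; lia.
by move: (j'E v) (j1E v); rewrite /flipped /= !excess_cons /excess big_nil; lia.
Qed.

Definition in_family n s (w : 'I_s -> 'X_{1..n}) (m : 'X_{1..n}) : Prop := exists k, w k = m.

Lemma congr_pairing (K : fieldType) n s (w : 'I_s -> 'X_{1..n}) i j P L :
  exchange_pairing (in_family w) (w i) (w j) P ->
  (forall v, w i v <= (w j v).+1 /\ w j v <= (w i v).+1)%N ->
  [seq l.2 | l <- L] = P ->
  exists i' j', [/\ congr_mod (@sym_exchange_binomial K n s w) ('X_i * 'X_j) ('X_i' * 'X_j'),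
     forall v, (w i' v)%:Z = (w i v)%:Z - excess (flipped L) v &
     forall v, (w j' v)%:Z = (w j v)%:Z + excess (flipped L) v].
Proof.
move=> pairP bal LP; have [ijP ijE swap] := pairP.
have [u1 u2] := uniq_pairing ijP ijE bal.
apply: congr_flips.
- by rewrite LP.
- by move: u1; rewrite -LP -map_comp.
- by move: u2; rewrite -LP -map_comp.
move=> L'; rewrite LP => L'P; have [_ [i' <-] i'E] := swap L' L'P.
by have [_ [j' <-] j'E] := exchange_pairing_complement pairP L'P; exists i', j'.
Qed.

(** The excess at [x] is positive, so some pair starts at [x]. It is exchanged alone, so the two
    factors may be far apart. *)
Lemma congr_single (K : fieldType) n s (w : 'I_s -> 'X_{1..n}) i j P (x : 'I_n) :
  exchange_pairing (in_family w) (w i) (w j) P -> (w j x < w i x)%N ->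
  exists i' j' y, [/\ congr_mod (@sym_exchange_binomial K n s w) ('X_i * 'X_j) ('X_i' * 'X_j'),
     (w i y < w j y)%N,
     forall v, (w i' v)%:Z = (w i v)%:Z - ((x == v)%:Z - (y == v)%:Z) &
     forall v, (w j' v)%:Z = (w j v)%:Z + ((x == v)%:Z - (y == v)%:Z)].
Proof.
move=> pairP ltx; have [ijP ijE swap] := pairP.
have [y xyP] : exists y, (x, y) \in P.
  have [/hasP[[x' y] pP /= /eqP <-]|/hasPn noP] := boolP (has (fun p => p.1 == x) P).
    by exists y.
  suff : excess P x <= 0 by rewrite -ijE; lia.
  rewrite /excess big_seq; apply: sumr_le0 => p /noP /= /negPf ->.
  by rewrite sub0r oppr_le0.
have [L LP fL] := flip_one xyP; have [_ [i' <-]] := swap L LP.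
have [_ [j' <-]] := exchange_pairing_complement pairP LP.
have e1 v : excess [:: (x, y)] v = (x == v)%:Z - (y == v)%:Z.
  by rewrite excess_cons /excess big_nil addr0.
rewrite fL => j'E i'E; have [_ /= lty] := ijP _ xyP.
exists i', j', y; split=> // [|v|v]; [|by rewrite -e1|by rewrite -e1].
by apply: (@congr_exchange K n s w i j i' j' x y) => // v; rewrite -e1.
Qed.

(** * Products of variables: balancing them and comparing balanced ones *)

Definition update d (T : Type) (f : 'I_d -> T) (i j : 'I_d) (a b : T) (k : 'I_d) : T :=
  if k == i then a else if k == j then b else f k.

Lemma big_two (R : Type) (idx : R) (op : Monoid.com_law idx) d (F : 'I_d -> R) i j : i != j ->
  \big[op/idx]_k F k = op (op (F i) (F j)) (\big[op/idx]_(k | (k != i) && (k != j)) F k).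
Proof. by move=> nij; rewrite (bigD1 i) //= (bigD1 j) 1?eq_sym //= Monoid.mulmA. Qed.

Lemma big_update2 (R T U : Type) (idx : R) (op : Monoid.com_law idx) d (F : T -> U -> R)
    (f : 'I_d -> T) (g : 'I_d -> U) i j a b a' b' : i != j ->
  \big[op/idx]_k F (update f i j a b k) (update g i j a' b' k) =
  op (op (F a a') (F b b')) (\big[op/idx]_(k | (k != i) && (k != j)) F (f k) (g k)).
Proof.
move=> nij; rewrite (big_two _ _ nij) /update !eqxx [j == i]eq_sym (negPf nij).
by congr (op _ _); apply: eq_bigr => k /andP[/negPf-> /negPf->].
Qed.

Lemma big_update (R T : Type) (idx : R) (op : Monoid.com_law idx) d (F : T -> R)
    (f : 'I_d -> T) i j a b : i != j ->
  \big[op/idx]_k F (update f i j a b k) =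
  op (op (F a) (F b)) (\big[op/idx]_(k | (k != i) && (k != j)) F (f k)).
Proof. by move=> nij; apply: (big_update2 _ (fun x _ => F x) f f _ _ a b nij). Qed.

Definition var_prod (K : fieldType) d s (f : 'I_d -> 'I_s) : {mpoly K[s]} := \prod_k 'X_(f k).

Lemma congr_update (K : fieldType) d s (S : {mpoly K[s]} -> Prop) (f : 'I_d -> 'I_s) i j a b :
  i != j -> congr_mod S ('X_(f i) * 'X_(f j)) ('X_a * 'X_b) ->
  congr_mod S (var_prod K f) (var_prod K (update f i j a b)).
Proof.
move=> nij cab; rewrite /var_prod (big_two _ _ nij).
by rewrite (big_update _ (fun k => 'X_k : {mpoly K[s]}) _ _ _ nij); apply: congr_modMr.
Qed.

Lemma ltn_sum_pos (I : finType) (F G : I -> nat) i :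
  (forall k, F k <= G k)%N -> (F i < G i)%N -> (\sum_k F k < \sum_k G k)%N.
Proof.
move=> leFG ltFG; rewrite (bigD1 i) // [X in (_ < X)%N](bigD1 i) //=.
by rewrite -addSn leq_add // leq_sum.
Qed.

Lemma sum_update d n s (w : 'I_s -> 'X_{1..n}) (f : 'I_d -> 'I_s) i j a b : i != j ->
  (forall v, w a v + w b v = w (f i) v + w (f j) v)%N ->
  forall v, (\sum_k w (update f i j a b k) v = \sum_k w (f k) v)%N.
Proof.
move=> nij wE v; rewrite (big_update _ (fun k => w k v) _ _ _ nij) /= wE.
by rewrite [RHS](big_two _ _ nij).
Qed.

Definition balanced d n s (w : 'I_s -> 'X_{1..n}) (f : 'I_d -> 'I_s) : bool :=
  [forall i, forall j, forall v, w (f i) v <= (w (f j) v).+1]%N.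

Lemma congr_balanced (K : fieldType) d n s (w : 'I_s -> 'X_{1..n}) (f : 'I_d -> 'I_s) :
  (forall i j, exists P, exchange_pairing (in_family w) (w i) (w j) P) ->
  exists g : 'I_d -> 'I_s,
    [/\ congr_mod (@sym_exchange_binomial K n s w) (var_prod K f) (var_prod K g),
        forall v, (\sum_k w (g k) v = \sum_k w (f k) v)%N & balanced w g].
Proof.
move=> pairing; have [t] := ubnP (\sum_k \sum_v w (f k) v ^ 2)%N.
elim: t f => // t IH f; rewrite ltnS => ltft.
have [bal|] := boolP (balanced w f); first by exists f; split=> //; apply: congr_mod_refl.
case/forallPn => i /forallPn[j /forallPn[x]]; rewrite -ltnNge => ltx.
have nij : i != j by apply: contraTneq ltx => ->; lia.
have [P pairP] := pairing (f i) (f j).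
have [|a [b [y [cab lty aE bE]]]] := @congr_single K n s w _ _ P x pairP; first exact: ltnW ltx.
have wE v : (w a v + w b v = w (f i) v + w (f j) v)%N by move: (aE v) (bE v); lia.
have [|g [fg gE bal]] := IH (update f i j a b).
  apply: leq_trans ltft; rewrite (big_update _ (fun k => \sum_v w k v ^ 2)%N _ _ _ nij).
  rewrite [X in (_ < X)%N](big_two _ _ nij) /= -addSn leq_add2r -!big_split /=.
  apply: (ltn_sum_pos (i := x)) => [v|].
    move: (aE v) (bE v); have [<-|nxv] := eqVneq x v.
      by have [E|nyx] := eqVneq y x; [move: lty; rewrite E|]; nia.
    by have [E|nyv] := eqVneq y v; [move: lty; rewrite E|]; nia.
  move: (aE x) (bE x); rewrite eqxx.
  by have [E|nyx] := eqVneq y x; [move: lty; rewrite E|]; nia.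
exists g; split=> // [|v]; last by rewrite gE (sum_update nij wE).
exact: congr_mod_trans (congr_update nij cab) fg.
Qed.

(** Reversing the pairs of [Q] turns the difference into a sum, so one balanced orientation of the
    union of both multigraphs suffices. *)
Lemma balanced_orientation2 n (P Q : seq ('I_n * 'I_n)) :
  exists L1 L2, [/\ [seq l.2 | l <- L1] = P, [seq l.2 | l <- L2] = Q &
    forall v, `|signed_excess L1 v - signed_excess L2 v| <= 1].
Proof.
have [L LPQ bal] := balanced_orientation (P ++ [seq (p.2, p.1) | p <- Q]).
pose L1 := take (size P) L; pose L2' := drop (size P) L.
exists L1, [seq (l.1, (l.2.2, l.2.1)) | l <- L2']; split=> [||v].
- by rewrite /L1 map_take LPQ take_size_cat.
- have : [seq l.2 | l <- L2'] = [seq (p.2, p.1) | p <- Q].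
    by rewrite /L2' map_drop LPQ drop_size_cat.
  move=> /(congr1 (map (fun p => (p.2, p.1)))); rewrite -!map_comp => E.
  by rewrite E -[RHS]map_id; apply: eq_map => -[].
have -> : signed_excess [seq (l.1, (l.2.2, l.2.1)) | l <- L2'] v = - signed_excess L2' v.
  by rewrite /signed_excess big_map -sumrN; apply: eq_bigr => l _ /=; rewrite -mulrN opprB.
by move: (bal v); rewrite -(cat_take_drop (size P) L) /signed_excess big_cat /= opprK.
Qed.

(** The l1 distance: of two opposite truncated differences at least one vanishes. *)
Definition dist n (m m' : 'X_{1..n}) : nat := \sum_v ((m v - m' v) + (m' v - m v)).

Lemma exists_gt_of_lt d (F G : 'I_d -> nat) i :
  (\sum_k F k = \sum_k G k)%N -> (F i < G i)%N -> exists j, (G j < F j)%N.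
Proof.
move=> eqFG ltFG; have [/existsP[j]|/existsPn noj] := boolP [exists j, (G j < F j)%N].
  by exists j.
have := @ltn_sum_pos _ F G i; rewrite eqFG ltnn => H.
suff : false by []. by apply: H => // k; rewrite leqNgt noj.
Qed.

(** The sum preserves the image in the toric ring, the bounds preserve [balanced], and the
    difference is what the orientation controls. *)
Lemma congr_balanced_pair (K : fieldType) n s (w : 'I_s -> 'X_{1..n}) i j P L :
  exchange_pairing (in_family w) (w i) (w j) P ->
  (forall v, w i v <= (w j v).+1 /\ w j v <= (w i v).+1)%N ->
  [seq l.2 | l <- L] = P ->
  exists a b, [/\ congr_mod (@sym_exchange_binomial K n s w) ('X_i * 'X_j) ('X_a * 'X_b),
     forall v, (w a v + w b v = w i v + w j v)%N,
     forall v, (minn (w i v) (w j v) <= w a v <= maxn (w i v) (w j v))%N &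
     forall v, (w a v)%:Z - (w b v)%:Z = signed_excess L v].
Proof.
move=> pairP bal LP; have [ijP ijE _] := pairP.
have [a [b [cab aE bE]]] := congr_pairing K pairP bal LP.
exists a, b; split=> // v; move: (aE v) (bE v) (ijE v) => {}aE {}bE {}ijE; first by lia.
  by move: (flipped_bounds v ijP LP); case: ifP; lia.
by rewrite signed_excessE LP; lia.
Qed.

(** In each coordinate every new exponent lies between two old ones; for [b] this follows from that
    for [a] because the sum is kept. *)
Lemma balanced_update d n s (w : 'I_s -> 'X_{1..n}) (f : 'I_d -> 'I_s) i j a b : i != j ->
  (forall v, w a v + w b v = w (f i) v + w (f j) v)%N ->
  (forall v, minn (w (f i) v) (w (f j) v) <= w a v <= maxn (w (f i) v) (w (f j) v))%N ->
  balanced w f -> balanced w (update f i j a b).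
Proof.
move=> nij abE abm bal; have bal' k l v : (w (f k) v <= (w (f l) v).+1)%N.
  by move/forallP: bal => /(_ k)/forallP/(_ l)/forallP/(_ v).
have between k v : exists k1 k2, (w (f k1) v <= w (update f i j a b k) v <= w (f k2) v)%N.
  rewrite /update; case: ifP => _; last case: ifP => _; last by exists k, k; rewrite leqnn.
    have [le|le] := leqP (w (f i) v) (w (f j) v); [exists i, j|exists j, i];
    by move: (abm v); lia.
  have [le|le] := leqP (w (f i) v) (w (f j) v); [exists i, j|exists j, i];
  by move: (abm v) (abE v); lia.
apply/forallP => k; apply/forallP => l; apply/forallP => v.
have [_ [k2 /andP[_ lek]]] := between k v; have [l1 [_ /andP[lel _]]] := between l v.
by apply: leq_trans lek (leq_trans (bal' k2 l1 v) _).
Qed.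

Lemma congr_of_balanced (K : fieldType) d n s (w : 'I_s -> 'X_{1..n}) (f g : 'I_d -> 'I_s) :
  injective w ->
  (forall i j, exists P, exchange_pairing (in_family w) (w i) (w j) P) ->
  balanced w f -> balanced w g ->
  (forall v, (\sum_k w (f k) v = \sum_k w (g k) v)%N) ->
  congr_mod (@sym_exchange_binomial K n s w) (var_prod K f) (var_prod K g).
Proof.
move=> winj pairing; have [t] := ubnP (\sum_k dist (w (f k)) (w (g k)))%N.
elim: t f g => // t IH f g; rewrite ltnS => ltfg balf balg fgE.
have [/eqfunP fg|] := boolP [forall k, f k == g k].
  have -> : var_prod K f = var_prod K g by apply: eq_bigr => k _; rewrite fg.
  exact: congr_mod_refl.
case/forallPn => i0 nfg.
(* The coordinate sums agree, so a difference at [i0] is compensated at another position by one of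
   opposite sign. *)
have [v [i [j [lti ltj]]]] : exists v i j,
    (w (g i) v < w (f i) v)%N /\ (w (f j) v < w (g j) v)%N.
  have [/existsP[v]|/existsPn eqw] := boolP [exists v, w (f i0) v != w (g i0) v]; last first.
    case/eqP: nfg; apply/winj/mnmP => v.
    by apply/eqP; have := eqw v; rewrite negbK.
  rewrite neq_ltn => /orP[lt0|lt0].
    have [j ltj] := exists_gt_of_lt (fgE v) lt0; by exists v, j, i0.
  have [j ltj] := exists_gt_of_lt (esym (fgE v)) lt0; by exists v, i0, j.
have nij : i != j by apply: contraTneq lti => ->; rewrite -leqNgt ltnW.
have [P pairP] := pairing (f i) (f j); have [Q pairQ] := pairing (g i) (g j).
have bal2 (h : 'I_d -> 'I_s) : balanced w h ->
    forall u, (w (h i) u <= (w (h j) u).+1 /\ w (h j) u <= (w (h i) u).+1)%N.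
  by move=> /forallP bal u; split;
    [move/forallP: (bal i) => /(_ j)|move/forallP: (bal j) => /(_ i)];
    move=> /forallP.
have [L1 [L2 [L1P L2Q bal12]]] := balanced_orientation2 P Q.
have [a [b [cab abE abm abL]]] := congr_balanced_pair K pairP (bal2 f balf) L1P.
have [a' [b' [cab' abE' abm' abL']]] := congr_balanced_pair K pairQ (bal2 g balg) L2Q.
apply: congr_mod_trans (congr_update nij cab) _.
apply: congr_mod_trans _ (congr_mod_sym (congr_update nij cab')).
apply: IH.
- apply: leq_trans ltfg.
  rewrite (big_update2 _ (fun x y => dist (w x) (w y)) f g _ _ _ _ nij)
    [X in (_ < X)%N](big_two _ _ nij).
  rewrite /= -addSn leq_add2r /dist -!big_split /=.
  (* Let s be the difference of the sums over the two positions, for [f] minus for [g], at [u]. The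
     new differences add up to s and are at most one apart, so by parity their absolute values add
     up to |s|. The old ones add up to at least |s|, and to more at [v], where the signs are
     opposite. *)
  apply: (ltn_sum_pos (i := v)) => [u|]; [move: u => u|move: (v) lti ltj => u lti ltj];
    move: (abE u) (abE' u) (abL u) (abL' u) (bal12 u) => h1 h2 h3 h4; rewrite -h3 -h4; lia.
- exact: balanced_update.
- exact: balanced_update.
by move=> u; rewrite !sum_update.
Qed.

Lemma congr_var_prod (K : fieldType) d n s (w : 'I_s -> 'X_{1..n}) (f g : 'I_d -> 'I_s) :
  injective w ->
  (forall i j, exists P, exchange_pairing (in_family w) (w i) (w j) P) ->
  (forall v, (\sum_k w (f k) v = \sum_k w (g k) v)%N) ->
  congr_mod (@sym_exchange_binomial K n s w) (var_prod K f) (var_prod K g).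
Proof.
move=> winj pairing fgE.
have [f' [ff' f'E balf]] := congr_balanced K f pairing.
have [g' [gg' g'E balg]] := congr_balanced K g pairing.
apply: congr_mod_trans ff' _; apply: congr_mod_trans _ (congr_mod_sym gg').
by apply: congr_of_balanced => // v; rewrite f'E g'E.
Qed.

(** * Minimal generators as degree vectors of matchings *)

(** The membership test for the monomial ideal I(G)^q, put on supports so that it passes through
    sums and products. *)
Definition edges_divide (K : fieldType) n (e : rel 'I_n) q (p : {mpoly K[n]}) : Prop :=
  forall m, m \in msupp p ->
  exists M, [/\ size M = q, all (fun p => e p.1 p.2) M & forall v, (degs M v <= m v)%N].

Lemma edges_divideM (K : fieldType) n (e : rel 'I_n) q q' (p p' : {mpoly K[n]}) :
  edges_divide e q p -> edges_divide e q' p' -> edges_divide e (q + q') (p * p').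
Proof.
move=> divp divp' _ /msuppM_le/allpairsP[[m m'] /=
  [/divp[M [szM eM leM]] /divp'[M' [szM' eM' leM']] ->]].
exists (M ++ M'); split=> [||v]; first by rewrite size_cat szM szM'.
  by rewrite all_cat eM.
by rewrite degs_cat !mnmDE leq_add.
Qed.

Lemma edges_divide0 (K : fieldType) n (e : rel 'I_n) (p : {mpoly K[n]}) : edges_divide e 0 p.
Proof. by move=> m _; exists [::]; split=> // v; rewrite degs_nil mnm0E. Qed.

Lemma edges_divide_ideal (K : fieldType) n (e : rel 'I_n) q (S : {mpoly K[n]} -> Prop) p :
  (forall g, S g -> edges_divide e q g) -> in_ideal S p -> edges_divide e q p.
Proof.
move=> divS [k [r [g [Sg ->]]]]; elim: k r g Sg => [|k IH] r g Sg m.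
  by rewrite big_ord0 msupp0.
rewrite big_ord_recl => /msuppD_le; rewrite mem_cat => /orP[|].
  by apply: (@edges_divideM K n e 0 q); [apply: edges_divide0 | apply/divS/Sg].
exact: IH.
Qed.

Lemma edges_divide_pow (K : fieldType) n (e : rel 'I_n) q (p : {mpoly K[n]}) :
  ideal_pow (@edge_ideal K n e) q p -> edges_divide e q p.
Proof.
apply: edges_divide_ideal => _ [f [If ->]]; elim: q f If => [|q IH] f If.
  exact: edges_divide0.
rewrite big_ord_recl; apply: (@edges_divideM K n e 1 q); last exact: IH.
apply: edges_divide_ideal (If ord0) => _ [i [j [eij ->]]] m.
rewrite -mpolyXD => /mem_msuppXP <-; exists [:: (i, j)]; split=> [//||v].
  by rewrite /= eij.
by rewrite degs_cons degs_nil addm0.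
Qed.

Lemma ideal_pow_degs (K : fieldType) n (e : rel 'I_n) (m : 'X_{1..n}) M :
  all (fun p => e p.1 p.2) M -> (forall v, degs M v <= m v)%N ->
  ideal_pow (@edge_ideal K n e) (size M) 'X_[m].
Proof.
move=> eM leM.
have -> : 'X_[m] = 'X_[m - degs M] * 'X_[degs M] :> {mpoly K[n]}.
  by rewrite -mpolyXD submK //; apply/mnm_lepP.
apply/in_idealMl/in_ideal_gen.
exists (fun i => 'X_(tnth (in_tuple M) i).1 * 'X_(tnth (in_tuple M) i).2); split=> [i|].
  apply: in_ideal_gen; exists (tnth (in_tuple M) i).1, (tnth (in_tuple M) i).2.
  by split=> //; apply: (allP eM); apply: mem_tnth.
rewrite -(big_tnth _ _ M xpredT (fun p => 'X_p.1 * 'X_p.2)) /degs.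
elim: (M) => [|p M' IH]; first by rewrite !big_nil mpolyX0.
by rewrite !big_cons !mpolyXD IH.
Qed.

(** All products of [q] edges have degree 2q, so none of them properly divides another. *)
Lemma min_genP (K : fieldType) n (e : rel 'I_n) c q m :
  min_gen K e c q m <-> matching_degrees e c q m.
Proof.
split=> [[[bm Im] minm]|[M [szM eM dM bm]]].
  have mm : m \in msupp ('X_[m] : {mpoly K[n]}) by rewrite msuppX inE.
  have [M [szM eM leM]] := edges_divide_pow Im mm.
  have bM : bounded_by c (degs M).
    by apply/forallP => v; apply: leq_trans (leM v) _; move/forallP: bm.
  exists M; split=> //; apply: minm; last exact/forallP.
  by split=> //; rewrite -szM; apply: ideal_pow_degs.
have Im : ideal_pow (@edge_ideal K n e) q 'X_[m].
  by rewrite -szM; apply: ideal_pow_degs => // v; rewrite dM.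
split=> // m' [bm' Im'] /forallP lem'.
have mm' : m' \in msupp ('X_[m'] : {mpoly K[n]}) by rewrite msuppX inE.
have [M' [szM' eM' leM']] := edges_divide_pow Im' mm'.
have eqdeg : mdeg (degs M') = mdeg m by rewrite -dM !mdeg_degs szM szM'.
have le_m'm : (m' <= m)%MM by apply/mnm_lepP.
have le_M'm' : (degs M' <= m')%MM by apply/mnm_lepP.
have /eqP : mdeg (m - m') = 0%N.
  have := congr1 (@mdeg n) (submK le_m'm); have := congr1 (@mdeg n) (submK le_M'm').
  by rewrite !mdegD; lia.
by rewrite mdeg_eq0 => /eqP E; rewrite -(submK le_m'm) E add0m.
Qed.

Lemma size_matching (K : fieldType) n (e : rel 'I_n) c q M :
  delta_c_eq K e c q -> all (fun p => e p.1 p.2) M -> bounded_by c (degs M) -> (size M <= q)%N.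
Proof.
move=> [_ no] eM bM; rewrite leqNgt; apply/negP => /no; apply.
by exists (degs M); split=> //; apply: ideal_pow_degs.
Qed.

(** * The toric map and its kernel *)

Definition image_mnm n s (w : 'I_s -> 'X_{1..n}) (m : 'X_{1..s}) : 'X_{1..n} :=
  (\sum_i w i *+ m i)%MM.

Lemma toric_mapX (K : fieldType) n s (w : 'I_s -> 'X_{1..n}) m :
  toric_map w ('X_[m] : {mpoly K[s]}) = 'X_[image_mnm w m].
Proof.
rewrite /toric_map comp_mpolyX /image_mnm (big_morph _ (@mpolyXD n K) (mpolyX0 n K)).
by apply: eq_bigr => i _; rewrite tnth_mktuple mpolyXn.
Qed.

Lemma image_mnmD n s (w : 'I_s -> 'X_{1..n}) m m' :
  image_mnm w (m + m') = (image_mnm w m + image_mnm w m')%MM.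
Proof.
rewrite /image_mnm -big_split; apply: eq_bigr => i _.
by apply/mnmP => v; rewrite !(mnmDE, mulmnE) mulnDr.
Qed.

Lemma image_mnmU n s (w : 'I_s -> 'X_{1..n}) i : image_mnm w U_(i) = w i.
Proof.
rewrite /image_mnm (bigD1 i) //= mnm1E eqxx mulm1n big1 ?addm0 // => j nij.
by rewrite mnm1E eq_sym (negPf nij) mulm0n.
Qed.

Lemma mnm_sumU s (m : 'X_{1..s}) :
  exists f : 'I_(mdeg m) -> 'I_s, m = (\sum_k U_(f k))%MM.
Proof.
have [l ml] : exists l, m = (\sum_(i <- l) U_(i))%MM.
  have [t] := ubnP (mdeg m); elim: t m => // t IH m; rewrite ltnS => ltm.
  have [->|] := eqVneq m 0%MM; first by exists [::]; rewrite big_nil.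
  rewrite -mdeg_eq0 mdegE sum_nat_eq0 => /forall_inPn[i _ mi].
  have lem : (U_(i) <= m)%MM by rewrite lep1mP.
  have [|l ml] := IH (m - U_(i))%MM; last first.
    by exists (i :: l); rewrite big_cons -ml addmC submK.
  by have := congr1 (@mdeg s) (submK lem); rewrite mdegD mdeg1; lia.
have szl : size l = mdeg m.
  rewrite ml mdeg_sum; under eq_bigr do rewrite mdeg1.
  by rewrite sum1_size.
rewrite -szl; exists (fun k => tnth (in_tuple l) k).
by rewrite -(big_tnth _ _ l xpredT (fun i => U_(i)%MM)).
Qed.

(** As all [w i] have the same positive degree, monomials with equal images have equal degrees, and
    so become products of variables over one index set. *)
Lemma congr_monomials (K : fieldType) n s (w : 'I_s -> 'X_{1..n}) q (m m' : 'X_{1..s}) :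
  injective w -> (0 < q)%N -> (forall i, mdeg (w i) = q) ->
  (forall i j, exists P, exchange_pairing (in_family w) (w i) (w j) P) ->
  image_mnm w m = image_mnm w m' ->
  congr_mod (@sym_exchange_binomial K n s w) 'X_[m] 'X_[m'].
Proof.
move=> winj q0 wq pairing mm'.
have deg_image m1 : mdeg (image_mnm w m1) = (mdeg m1 * q)%N.
  rewrite mdeg_sum mdegE big_distrl; apply: eq_bigr => i _.
  by rewrite mdegMn wq mulnC.
have dmm' : mdeg m' = mdeg m by apply/eqP; rewrite -(eqn_pmul2r q0) -!deg_image mm'.
have [f mf] := mnm_sumU m.
have [g m'g] : exists g : 'I_(mdeg m) -> 'I_s, m' = (\sum_k U_(g k))%MM.
  by rewrite -dmm'; apply: mnm_sumU.
have XE d (h : 'I_d -> 'I_s) : 'X_[\sum_k U_(h k)] = var_prod K h.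
  by rewrite (big_morph _ (@mpolyXD s K) (mpolyX0 s K)).
have imE d (h : 'I_d -> 'I_s) : image_mnm w (\sum_k U_(h k)) = (\sum_k w (h k))%MM.
  have im0 : image_mnm w 0 = 0%MM by rewrite /image_mnm big1 // => i _; rewrite mnm0E mulm0n.
  by rewrite (big_morph _ (image_mnmD w) im0); apply: eq_bigr => k _; rewrite image_mnmU.
rewrite mf m'g !XE; apply: congr_var_prod => // v.
by rewrite -!mnm_sumE -!imE -mf -m'g mm'.
Qed.

Lemma toric_mapE (K : fieldType) n s (w : 'I_s -> 'X_{1..n}) (p : {mpoly K[s]}) :
  toric_map w p = \sum_(m <- msupp p) p@_m *: 'X_[image_mnm w m].
Proof.
rewrite /toric_map comp_mpolyE; apply: eq_bigr => m _.
by rewrite -toric_mapX /toric_map comp_mpolyX.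
Qed.

(* The terms of [p] with a given image cancel, so a monomial of [p] has a partner
   with the same image; subtracting the binomial of the two shrinks the support. *)
Lemma toric_kernel_sub (K : fieldType) n s (w : 'I_s -> 'X_{1..n}) (S : {mpoly K[s]} -> Prop) p :
  (forall m m', image_mnm w m = image_mnm w m' -> congr_mod S 'X_[m] 'X_[m']) ->
  toric_map w p = 0 -> in_ideal S p.
Proof.
move=> congrX; have [t] := ubnP (size (msupp p)); elim: t p => // t IH p; rewrite ltnS => ltp p0.
have [->|/eqP nz] := eqVneq p 0; first exact: in_ideal0.
have [m mp] : exists m, m \in msupp p.
  by case E: (msupp p) => [|m l]; [move/msuppnil0: E|exists m; rewrite mem_head].
have [m' m'p [nmm' im]] : exists2 m', m' \in msupp p & m' != m /\ image_mnm w m' = image_mnm w m.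
  have [/hasP[m' m'p /andP[nmm' /eqP im]]|/hasPn nom] := boolP
      (has (fun m' => (m' != m) && (image_mnm w m' == image_mnm w m)) (msupp p)).
    by exists m'.
  (* Otherwise the coefficient of the image of [m] in the image of [p] would be that of [m] in [p],
     which is nonzero. *)
  have := congr1 (mcoeff (image_mnm w m)) p0.
  rewrite toric_mapE mcoeff0 raddf_sum /= (bigD1_seq m) //= big_seq_cond.
  rewrite big1 => [|m1 /andP[m1p nm1]]; last first.
    by rewrite mcoeffZ mcoeffX; move: (nom m1 m1p); rewrite nm1 /= => /negPf->; rewrite mulr0.
  rewrite mcoeffZ mcoeffX eqxx mulr1 addr0 => pm0.
  by move: mp; rewrite mcoeff_msupp pm0 eqxx.
pose r : {mpoly K[s]} := p@_m *: ('X_[m] - 'X_[m']).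
have rS : in_ideal S r.
  by rewrite /r -mul_mpolyC; apply/in_idealMl/congrX; rewrite im.
rewrite -[p](subrK r); apply: in_idealD => //; apply: IH; last first.
  by move: p0; rewrite /r /toric_map comp_mpolyB comp_mpolyZ comp_mpolyB -!/(toric_map _ _)
    !toric_mapX im subrr scaler0 subr0.
apply: leq_trans ltp; rewrite (perm_size (perm_to_rem mp)) /= ltnS.
(* Subtracting [r] removes [m], and [m'] was in the support already. *)
apply: uniq_leq_size => // m1; rewrite mcoeff_msupp /r mcoeffB mcoeffZ mcoeffB !mcoeffX => nz1.
rewrite mem_rem_uniq // inE; apply/andP; split.
  by apply: contraNneq nz1 => ->; rewrite eqxx (negPf nmm') subr0 mulr1 subrr.
rewrite mcoeff_msupp; apply: contraNneq nz1 => pm1.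
have /negPf-> : m != m1 by apply: contraTneq mp => ->; rewrite mcoeff_msupp pm1 eqxx.
have /negPf-> : m' != m1 by apply: contraTneq m'p => ->; rewrite mcoeff_msupp pm1 eqxx.
by rewrite pm1 subrr mulr0 subr0.
Qed.

Lemma toric_map_exchange (K : fieldType) n s (w : 'I_s -> 'X_{1..n}) (p : {mpoly K[s]}) :
  sym_exchange_binomial w p -> toric_map w p = 0.
Proof.
case=> i [j [i' [j' [x [y [ltx [lty [i'E [j'E ->]]]]]]]]].
rewrite /toric_map comp_mpolyB -!/(toric_map _ _) -!mpolyXD !toric_mapX !image_mnmD !image_mnmU.
suff -> : (w i + w j = w i' + w j')%MM by rewrite subrr.
apply/mnmP => v; rewrite !mnmDE i'E j'E.
have [->|nxv] := eqVneq v x; have [E|nyv] := eqVneq _ y.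
- by move: ltx lty; rewrite E; lia.
- by move: ltx lty; lia.
- by move: ltx lty; rewrite E; lia.
- by rewrite !addn0 !subn0.
Qed.

Theorem theorem5p2 (K : fieldType) (n : nat) (e : rel 'I_n) (c : 'I_n -> nat)
    (s : nat) (w : 'I_s -> 'X_{1..n}) :
  simple_graph_no_isolated e ->
  (forall i, 0 < c i)%N ->
  delta_c_eq K e c 2 ->
  (* w_0, ..., w_{s-1} is an enumeration (without repetition) of B(G, c) *)
  injective w ->
  (forall m, min_gen K e c 2 m <-> exists i, w i = m) ->
  exists S : {mpoly K[s]} -> Prop,
    (forall p, S p -> sym_exchange_binomial w p) /\
    (forall p, toric_map w p = 0 <-> in_ideal S p).
Proof.
move=> _ _ delta2 winj wB; exists (@sym_exchange_binomial K n s w); split=> // p.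
have wP m : matching_degrees e c 2 m <-> in_family w m.
  by split=> [/(min_genP K)/wB | /wB/min_genP].
split=> [|[k [r [g [Sg ->]]]]].
  apply: toric_kernel_sub => m m'.
  (* 4 is the degree of a product of two edges. *)
  apply: (@congr_monomials K n s w 4) => // [i|i j].
    by have [M [szM _ <- _]] := (wP (w i)).2 (ex_intro _ i erefl); rewrite mdeg_degs szM.
  have [P [Pij Pexc Pswap]] := matching_strong_exchange
    (fun M => size_matching delta2 (M := M)) ((wP (w i)).2 (ex_intro _ i erefl))
    ((wP (w j)).2 (ex_intro _ j erefl)).
  by exists P; split=> // L /Pswap[m1 /wP wm1 m1E]; exists m1.
rewrite /toric_map raddf_sum big1 // => i _.
by rewrite /= rmorphM /= -!/(toric_map _ _) (toric_map_exchange (Sg i)) mulr0.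
Qed.
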